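(* Let $G=(V,E,W)$ be an undirected matrix-weighted graph with vertex set $V=\{v_1,\ldots,v_n\}$, edge set $E$, and symmetric positive semidefinite matrix weights $\mathbf{A}_{ij}=\mathbf{A}_{ji}\in\mathbb{R}^{d\times d}$ for $(v_i,v_j)\in E$, and let $\mathbf{L}$ be its matrix-weighted Laplacian. Then: (i) Two vertices $v_i,v_j\in V$ belong to a same cluster if $\dim\big(\ker(\mathcal{S}_{ij})\big)=0$. (ii) The graph $G$ is connected if $\dim\big(\ker(\mathcal{S}_{ij})\big)=0$ holds for all pairs of distinct vertices $v_i,v_j\in V$.
   Context: The graph has no self-loops and no multi-edges; $d\ge 2$. The matrix-weighted Laplacian is $\mathbf{L}=\mathbf{D}-\mathbf{A}\in\mathbb{R}^{dn\times dn}$, where $\mathbf{A}=[\mathbf{A}_{ij}]$ is the block adjacency matrix (with $\mathbf{A}_{ij}=\mathbf{0}_{d\times d}$ if $(v_i,v_j)\notin E$ or $i=j$) and $\mathbf{D}=\mathrm{blkdiag}(\mathbf{D}_1,\ldots,\mathbf{D}_n)$ with $\mathbf{D}_i=\sum_{j:(v_i,v_j)\in E}\mathbf{A}_{ij}$. $G$ is called connected if $\mathrm{rank}(\mathbf{L})=dn-d$. Two vertices $v_i,v_j$ belong to a same cluster if for every $\mathbf{x}=[\mathbf{x}_1^\top,\ldots,\mathbf{x}_n^\top]^\top\in\ker(\mathbf{L})$ (with $\mathbf{x}_k\in\mathbb{R}^d$) one has $\mathbf{x}_i=\mathbf{x}_j$. The parallel sum of symmetric positive semidefinite $d\times d$ matrices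 is $\mathbf{A}_1\wedge\mathbf{A}_2=\mathbf{A}_1(\mathbf{A}_1+\mathbf{A}_2)^{\dagger}\mathbf{A}_2$ (with $\dagger$ the Moore–Penrose pseudoinverse), applied sequentially for several matrices. For a path $\mathcal{P}=u_1u_2\cdots u_{\ell+1}$ in $G$ (consecutive vertices adjacent), $\ker(\mathcal{P}):=\ker\big(\mathbf{A}_{u_1u_2}\wedge\mathbf{A}_{u_2u_3}\wedge\cdots\wedge\mathbf{A}_{u_\ell u_{\ell+1}}\big)$ (this is the subspace spanned by the kernels of the edge weights along the path). $\mathcal{S}_{ij}$ denotes the set of all simple paths (no repeated vertices) from $v_i$ to $v_j$, and $\ker(\mathcal{S}_{ij}):=\bigcap_{\mathcal{P}\in\mathcal{S}_{ij}}\ker(\mathcal{P})$. Throughout, $G$ is assumed topologically connected (the underlying unweighted graph is connected). *)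

(* Defs.v *)
From mathcomp Require Import all_boot all_order all_algebra.
From mathcomp Require Import classical_sets reals.

Set Implicit Arguments.
Unset Strict Implicit.
Unset Printing Implicit Defensive.

Import Order.TTheory GRing.Theory Num.Theory.
Local Open Scope ring_scope.

Section LinearAlgebra.
Variable R : realFieldType.

Definition psdmx d (A : 'M[R]_d) : Prop :=
  A^T = A /\ forall x : 'cV[R]_d, 0 <= (x^T *m A *m x) 0 0.

(* MathComp's kermx is the kernel of right multiplication on row vectors; *)
(* this is the usual {x | M x = 0}, made of column vectors.               *)
Definition cker m n (M : 'M[R]_(m, n)) : {vspace 'cV[R]_n} :=
  lker (linfun (mulmx M : 'cV[R]_n -> 'cV[R]_m)).

Lemma ckerP m n (M : 'M[R]_(m, n)) (x : 'cV[R]_n) :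
  reflect (M *m x = 0) (x \in cker M).
Proof. by rewrite memv_ker lfunE; apply: eqP. Qed.

Definition penrose m n (A : 'M[R]_(m, n)) (X : 'M[R]_(n, m)) : Prop :=
  [/\ A *m X *m A = A, X *m A *m X = X,
      (A *m X)^T = A *m X & (X *m A)^T = X *m A].

Lemma penrose_inj m n (A : 'M[R]_(m, n)) X Y :
  penrose A X -> penrose A Y -> X = Y.
Proof.
case=> AXA XAX AXs XAs [AYA YAY AYs YAs].
have AXY : A *m X = A *m Y.
  by rewrite -AXs -{1}AYA -mulmxA trmx_mul AXs AYs mulmxA AXA.
have XYA : X *m A = Y *m A.
  have -> : X *m A = (X *m A) *m (Y *m A) by rewrite -[in LHS]AYA !mulmxA.
  by rewrite -XAs -YAs -trmx_mul -mulmxA (mulmxA A) AXA.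
by rewrite -XAX XYA -mulmxA AXY mulmxA.
Qed.

Lemma gram_unit r n (B : 'M[R]_(r, n)) : row_free B -> B *m B^T \in unitmx.
Proof.
move=> fB; rewrite -row_free_unit; apply/inj_row_free => v vBB0.
apply/eqP; rewrite -(mulmx_free_eq0 v fB); apply/eqP.
have : (v *m B) *m (v *m B)^T = 0 by rewrite trmx_mul !mulmxA -(mulmxA v) vBB0 mul0mx.
move=> /matrixP/(_ 0 0); rewrite !mxE => /eqP.
rewrite psumr_eq0; last by move=> i _; rewrite [_^T _ _]mxE -expr2 sqr_ge0.
move=> /allP H; apply/rowP => j; rewrite [RHS]mxE; apply/eqP.
by have := H j (mem_index_enum j); rewrite [_^T _ _]mxE -expr2 sqrf_eq0.
Qed.

Lemma penrose_ex m n (A : 'M[R]_(m, n)) : exists X, penrose A X.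
Proof.
have uB := gram_unit (row_base_free A).
have fC : row_free (col_base A)^T.
  by rewrite /row_free mxrank_tr; apply: col_base_full.
have uC := gram_unit fC; rewrite trmxK in uC.
rewrite -(mulmx_base A).
move: (col_base A) (row_base A) uB uC => C B uB uC {fC}.
pose X := B^T *m invmx (B *m B^T) *m invmx (C^T *m C) *m C^T.
have BX : B *m X = invmx (C^T *m C) *m C^T by rewrite /X !mulmxA mulmxV // mul1mx.
have XC : X *m C = B^T *m invmx (B *m B^T) by rewrite /X -!mulmxA mulVmx // mulmx1.
have AX : C *m B *m X = C *m invmx (C^T *m C) *m C^T by rewrite -mulmxA BX mulmxA.
have XA : X *m (C *m B) = B^T *m invmx (B *m B^T) *m B by rewrite mulmxA XC.
exists X; split.
- by rewrite AX mulmxA -(mulmxA _ C^T C) -(mulmxA C) mulVmx // mulmx1.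
- by rewrite XA -(mulmxA _ B X) BX /X !mulmxA.
- by rewrite AX !trmx_mul trmxK trmx_inv trmx_mul trmxK mulmxA.
- by rewrite XA !trmx_mul trmxK trmx_inv trmx_mul trmxK mulmxA.
Qed.

(* MathComp's pinvmx is only a one-sided partial inverse, not the     *)
(* Moore-Penrose one. The default 0 is never used, see mpinvP; the    *)
(* value is the only solution of the Penrose equations (penrose_inj). *)
Definition mpinv m n (A : 'M[R]_(m, n)) : 'M[R]_(n, m) :=
  xget 0 [set X | penrose A X]%classic.

Lemma mpinvP m n (A : 'M[R]_(m, n)) : penrose A (mpinv A).
Proof. by have [X AX] := penrose_ex A; exact: (@xgetI _ 0 _ X AX). Qed.

Definition parsum d (A B : 'M[R]_d) : 'M[R]_d := A *m mpinv (A + B) *m B.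

End LinearAlgebra.

(* The values of mw_weight off the edge set are irrelevant: they are *)
(* replaced by 0 in mw_adj, the only use of mw_weight below.         *)
Record mwgraph (R : realFieldType) (d n : nat) := MWGraph {
  mw_edge : rel 'I_n;
  mw_weight : 'I_n -> 'I_n -> 'M[R]_d;
  mw_edge_sym : symmetric mw_edge;
  mw_edge_irr : irreflexive mw_edge;
  mw_weight_sym : forall i j, mw_edge i j -> mw_weight i j = mw_weight j i;
  mw_weight_psd : forall i j, mw_edge i j -> psdmx (mw_weight i j)
}.

Section MatrixWeightedGraph.
Variables (R : realFieldType) (d n : nat) (G : mwgraph R d n).

Definition mw_adj (i j : 'I_n) : 'M[R]_d :=
  if mw_edge G i j then mw_weight G i j else 0.

Definition mw_degree (i : 'I_n) : 'M[R]_d :=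
  \sum_(j < n | mw_edge G i j) mw_adj i j.

(* The dimension \sum_(i < n) d is the d n of the block structure. *)
Definition mw_laplacian : 'M[R]_(\sum_(i < n) d) :=
  (\mxdiag_(i < n) mw_degree i) - (\mxblock_(i < n, j < n) mw_adj i j).

Definition mw_connected : Prop := \rank mw_laplacian = (d * n - d)%N.

Definition same_cluster (i j : 'I_n) : Prop :=
  forall x : 'cV[R]_(\sum_(i < n) d),
    x \in cker mw_laplacian -> submxcol x i = submxcol x j.

Definition topologically_connected : Prop :=
  forall i j : 'I_n, connect (mw_edge G) i j.

(* Paths u_1 u_2 ... are given by their head u and their tail p; the list *)
(* of weights is A_{u_1 u_2}, A_{u_2 u_3}, ..., combined from the left.   *)
(* A path with no edge (a simple path from a vertex to itself) gets the   *)
(* kernel 0, which is the span of an empty family of edge kernels.        *)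
Definition path_weight (u : 'I_n) (p : seq 'I_n) : 'M[R]_d :=
  if pairmap mw_adj u p is A :: s then foldl (@parsum R d) A s else 1%:M.

Definition path_ker (u : 'I_n) (p : seq 'I_n) : {vspace 'cV[R]_d} :=
  cker (path_weight u p).

Definition simple_path (i j : 'I_n) (p : seq 'I_n) : bool :=
  [&& path (mw_edge G) i p, last i p == j & uniq (i :: p)].

Lemma size_simple_path i j p : simple_path i j p -> (size p <= n)%N.
Proof.
case/and3P=> _ _ /card_uniqP cardp.
by have := max_card (mem (i :: p)); rewrite cardp card_ord => /ltnW.
Qed.

(* By size_simple_path, p ranges over the tails of all simple paths. *)
Definition paths_ker (i j : 'I_n) : {vspace 'cV[R]_d} :=
  (\bigcap_(p : n.-bseq 'I_n | simple_path i j p) path_ker i p)%VS.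

End MatrixWeightedGraph.

(* Main.v *)
(** A kernel vector [x] of the Laplacian annihilates the quadratic form
    [\sum_(i, j) (x_i - x_j)^T A_ij (x_i - x_j)], all of whose terms are
    nonnegative, so [x_i - x_j] lies in [ker A_ij] for every edge. The parallel
    sum of positive semidefinite matrices is positive semidefinite and its
    kernel contains both kernels, so along a path these differences telescope
    to an element of the kernel of the path. If [paths_ker i j = 0], this gives
    [x_i = x_j]. When this holds for all pairs, the kernel of the Laplacian
    consists of the vectors with equal blocks, which has dimension [d]. *)
Require Import Defs.
From mathcomp Require Import all_boot all_order all_algebra.
From mathcomp Require Import reals.
From mathcomp Require Import ring lra.

Set Implicit Arguments.
Unset Strict Implicit.
Unset Printing Implicit Defensive.

Import Order.TTheory GRing.Theory Num.Theory.
Local Open Scope ring_scope.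

Section PositiveSemidefinite.
Variable R : realFieldType.

Lemma psdmx0 d : psdmx (0 : 'M[R]_d).
Proof. by split=> [|x]; rewrite ?trmx0 // mulmx0 mul0mx mxE. Qed.

Lemma psdmxD d (A B : 'M[R]_d) : psdmx A -> psdmx B -> psdmx (A + B).
Proof.
move=> [sA pA] [sB pB]; split=> [|x]; first by rewrite linearD /= sA sB.
by rewrite mulmxDr mulmxDl mxE addr_ge0.
Qed.

Lemma psdmx_congr d e (A : 'M[R]_d) (C : 'M[R]_(d, e)) :
  psdmx A -> psdmx (C^T *m A *m C).
Proof.
move=> [sA pA]; split=> [|x]; first by rewrite !trmx_mul trmxK sA mulmxA.
by have := pA (C *m x); rewrite trmx_mul !mulmxA.
Qed.

(** At [t = - a / (b + 1)] the form equals [- a ^+ 2 * (b + 2) / (b + 1) ^+ 2]; the denominator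
    [b + 1] also covers [b = 0]. *)
Lemma quadratic_ge0_linear_coef_eq0 (a b : R) :
  0 <= b -> (forall t, 0 <= 2 * t * a + t ^+ 2 * b) -> a = 0.
Proof.
move=> b_ge0 /(_ (- a / (b + 1))); have b1 : b + 1 != 0 by lra.
have -> : 2 * (- a / (b + 1)) * a + (- a / (b + 1)) ^+ 2 * b =
          - (a ^+ 2 * ((b + 2) / (b + 1) ^+ 2)) by field.
have c_gt0 : 0 < (b + 2) / (b + 1) ^+ 2.
  by rewrite divr_gt0 ?exprn_even_gt0 //; lra.
rewrite oppr_ge0 pmulr_lle0 // => a2.
by apply/eqP; rewrite -sqrf_eq0 eq_le a2 sqr_ge0.
Qed.

Lemma norm2_mx_eq0 d (x : 'cV[R]_d) : (x^T *m x) 0 0 = 0 -> x = 0.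
Proof.
rewrite mxE => /eqP; rewrite psumr_eq0 => [/allP x0|i _]; last first.
  by rewrite mxE -expr2 sqr_ge0.
apply/colP => i; rewrite [RHS]mxE; apply/eqP.
by have := x0 i (mem_index_enum i); rewrite mxE -expr2 sqrf_eq0.
Qed.

(* The form at [x + t A x] is [2 t |A x|^2 + O(t^2)], which is negative for *)
(* small [t < 0] unless [A x = 0].                                         *)
Lemma psdmx_form_eq0 d (A : 'M[R]_d) (x : 'cV[R]_d) :
  psdmx A -> (x^T *m A *m x) 0 0 = 0 -> A *m x = 0.
Proof.
move=> [sA pA] x0; apply: norm2_mx_eq0.
set y := A *m x; set a := (y^T *m y) 0 0; set b := (y^T *m A *m y) 0 0.
have b_ge0 : 0 <= b by exact: pA.
have eD (M N : 'M[R]_1) : (M + N) 0 0 = M 0 0 + N 0 0 by rewrite mxE.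
have eZ t (M : 'M[R]_1) : (t *: M) 0 0 = t * M 0 0 by rewrite mxE.
have form t : 0 <= 2 * t * a + t ^+ 2 * b.
  have yAx : y^T *m A *m x = y^T *m y by rewrite -mulmxA.
  have xAy : x^T *m A *m y = y^T *m y by rewrite {2}/y trmx_mul sA.
  have tr_xy : (x + t *: y)^T = x^T + t *: y^T by rewrite linearD linearZ.
  have := pA (x + t *: y); rewrite tr_xy.
  rewrite !mulmxDl !mulmxDr -!scalemxAl -!scalemxAr yAx xAy.
  by rewrite !(eD, eZ) -/a -/b x0; lra.
exact: quadratic_ge0_linear_coef_eq0 b_ge0 form.
Qed.

(** The forms of [A] and [B] at [x] are nonnegative with sum zero, so both vanish. *)
Lemma cker_psdmxD d (A B : 'M[R]_d) (x : 'cV[R]_d) :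
  psdmx A -> psdmx B -> (A + B) *m x = 0 -> A *m x = 0.
Proof.
move=> psdA psdB ABx; apply: psdmx_form_eq0 => //.
have : (x^T *m (A + B) *m x) 0 0 = 0 by rewrite -mulmxA ABx mulmx0 mxE.
have := psdA.2 x; have := psdB.2 x.
by rewrite mulmxDr mulmxDl [X in _ -> _ -> X = _ -> _]mxE; lra.
Qed.

Lemma mpinv_sym d (S : 'M[R]_d) : S^T = S -> (mpinv S)^T = mpinv S.
Proof.
move=> sS; apply: (@penrose_inj _ _ _ S); last exact: mpinvP.
have [SXS XSX SXs XSs] := mpinvP S; split.
- by rewrite -[RHS]sS -[in RHS]SXS !trmx_mul sS mulmxA.
- by rewrite -[in RHS]XSX !trmx_mul sS mulmxA.
- by rewrite trmx_mul trmxK sS -XSs trmx_mul sS.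
- by rewrite trmx_mul trmxK sS -SXs trmx_mul sS.
Qed.

(** With [S = A + B], the columns of [1%:M - mpinv S *m S] lie in the kernel of [S], hence in that
    of [A]. *)
Lemma psdmx_mulmx_mpinvD d (A B : 'M[R]_d) : psdmx A -> psdmx B ->
  A *m mpinv (A + B) *m (A + B) = A.
Proof.
move=> psdA psdB; have [SXS _ _ _] := mpinvP (A + B).
set S := A + B in SXS *.
suff : A *m (1%:M - mpinv S *m S) = 0.
  by rewrite mulmxBr mulmx1 mulmxA => /eqP; rewrite subr_eq0 => /eqP.
have S0 : S *m (1%:M - mpinv S *m S) = 0 by rewrite mulmxBr mulmx1 mulmxA SXS subrr.
apply: trmx_inj; apply/row_matrixP => j; rewrite trmx0 row0 -tr_col colE -mulmxA.
by rewrite (cker_psdmxD psdA psdB) ?trmx0 // mulmxA S0 mul0mx.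
Qed.

(** Substituting [B = S - A] turns both sides into [A - A *m mpinv S *m A]. *)
Lemma parsumC d (A B : 'M[R]_d) : psdmx A -> psdmx B -> parsum A B = parsum B A.
Proof.
move=> psdA psdB; rewrite /parsum [B + A]addrC.
have ASS := psdmx_mulmx_mpinvD psdA psdB; set S := A + B in ASS *.
have [sS _] := psdmxD psdA psdB.
have SSA : S *m mpinv S *m A = A.
  by rewrite -[RHS]psdA.1 -[in RHS]ASS !trmx_mul psdA.1 sS mpinv_sym // mulmxA.
have BE : B = S - A by rewrite /S addrC addKr.
by rewrite [in LHS]BE [in RHS]BE mulmxBr !mulmxBl ASS SSA.
Qed.

Lemma parsum_psdmx d (A B : 'M[R]_d) : psdmx A -> psdmx B -> psdmx (parsum A B).
Proof.
move=> psdA psdB; have [sS _] := psdmxD psdA psdB.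
have ASB := parsumC psdA psdB; have [_ XSX _ _] := mpinvP (A + B).
have sX := mpinv_sym sS.
rewrite /parsum [B + A]addrC in ASB; rewrite /parsum.
set X := mpinv (A + B) in ASB XSX sX *.
(* Expand [X = X *m (A + B) *m X] in the middle, then swap factors by [A *m X *m B = B *m X *m A]:
   both terms become congruences. *)
suff -> : A *m X *m B =
    (X *m A)^T *m B *m (X *m A) + (X *m B)^T *m A *m (X *m B).
  by apply: psdmxD; apply: psdmx_congr.
rewrite !trmx_mul sX psdA.1 psdB.1 -{1}XSX mulmxDr mulmxDl mulmxDr mulmxDl.
rewrite !mulmxA; congr (_ + _); last by rewrite ASB.
by move: ASB; rewrite -!mulmxA => ->.
Qed.

Lemma parsum_cker_r d (A B : 'M[R]_d) (x : 'cV[R]_d) :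
  B *m x = 0 -> parsum A B *m x = 0.
Proof. by move=> Bx; rewrite /parsum -mulmxA Bx mulmx0. Qed.

Lemma parsum_cker_l d (A B : 'M[R]_d) (x : 'cV[R]_d) :
  psdmx A -> psdmx B -> A *m x = 0 -> parsum A B *m x = 0.
Proof. by move=> psdA psdB Ax; rewrite parsumC //; apply: parsum_cker_r. Qed.

End PositiveSemidefinite.

Section Laplacian.
Variables (R : realFieldType) (d n : nat) (G : mwgraph R d n).

Lemma mw_adj_psdmx i j : psdmx (mw_adj G i j).
Proof. by rewrite /mw_adj; case: ifP => [/mw_weight_psd|_]//; exact: psdmx0. Qed.

Lemma mw_adj_sym i j : mw_adj G i j = mw_adj G j i.
Proof. by rewrite /mw_adj mw_edge_sym; case: ifP => // /mw_weight_sym. Qed.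

Lemma mw_degreeE i : mw_degree G i = \sum_j mw_adj G i j.
Proof.
rewrite /mw_degree big_mkcond; apply: eq_bigr => j _.
by rewrite /mw_adj; case: (mw_edge G i j).
Qed.

Lemma mw_laplacian_sym : (mw_laplacian G)^T = mw_laplacian G.
Proof.
rewrite /mw_laplacian linearB /= tr_mxdiag tr_mxblock; congr (_ - _).
  apply: eq_mxdiag => i; rewrite mw_degreeE linear_sum.
  by apply: eq_bigr => j _; case: (mw_adj_psdmx i j).
by apply: eq_mxblock => i j; rewrite mw_adj_sym; case: (mw_adj_psdmx i j).
Qed.

Lemma submxcol_mw_laplacian_mul m (C : 'M[R]_(\sum_(i < n) d, m)) i :
  submxcol (mw_laplacian G *m C) i =
  \sum_j mw_adj G i j *m (submxcol C i - submxcol C j).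
Proof.
rewrite -{1}[C]submxcolK mulmxBl mul_mxdiag_mxcol mul_mxblock_mxrow -mxcolB mxcolK.
rewrite mw_degreeE mulmx_suml -sumrB.
by apply: eq_bigr => j _; rewrite mulmxBr.
Qed.

Lemma mw_laplacian_cker_edge (x : 'cV[R]_(\sum_(i < n) d)) i j :
  mw_laplacian G *m x = 0 -> mw_adj G i j *m (submxcol x i - submxcol x j) = 0.
Proof.
move=> Lx0; apply: psdmx_form_eq0; first exact: mw_adj_psdmx.
pose y k : 'cV[R]_d := submxcol x k.
(* Summed over [l], [q k l] is the product of block [k] of [x] with block [k] of [L x], hence zero;
   symmetrizing [q] gives the edge form [f]. *)
pose q k l := (((y k)^T *m mw_adj G k l *m (y k - y l)) : 'M[R]_1) 0 0.
pose f k l := (((y k - y l)^T *m mw_adj G k l *m (y k - y l)) : 'M[R]_1) 0 0.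
have qf k l : q k l + q l k = f k l.
  have tr_y : (y k - y l)^T = (y k)^T - (y l)^T by rewrite linearB.
  rewrite /q /f tr_y mulmxBl mulmxBl [X in _ = X]mxE; congr (_ + _).
  by rewrite [in RHS]mxE mw_adj_sym -[y k - y l]opprB mulmxN [in RHS]mxE opprK.
have q0 : \sum_k \sum_l q k l = 0.
  apply: big1 => k _.
  have := submxcol_mw_laplacian_mul x k; rewrite Lx0 submxcol0 => Lk.
  have : (((y k)^T *m (0 : 'cV[R]_d)) : 'M[R]_1) 0 0 = 0 by rewrite mulmx0 mxE.
  rewrite Lk mulmx_sumr summxE => Q; rewrite -[RHS]Q.
  by apply: eq_bigr => l _; rewrite /q mulmxA.
have f_ge0 k l : 0 <= f k l by exact: (mw_adj_psdmx k l).2.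
have f0 : \sum_k \sum_l f k l = 0.
  under eq_bigr => k _ do (under eq_bigr => l _ do rewrite -qf; rewrite big_split).
  by rewrite big_split /= q0 exchange_big /= q0 addr0.
have sf_ge0 k : 0 <= \sum_l f k l by apply: sumr_ge0.
move/eqP: f0; rewrite psumr_eq0 // => /allP/(_ i (mem_index_enum i)) /=.
by rewrite psumr_eq0 // => /allP/(_ j (mem_index_enum j)) /eqP.
Qed.

(** Generalized for induction: [A] is the parallel sum accumulated up to [u], and [z] the difference
    accumulated so far, which [A] kills. *)
Lemma foldl_parsum_telescope (y : 'I_n -> 'cV[R]_d) :
  (forall i j, mw_adj G i j *m (y i - y j) = 0) ->
  forall p u A z, psdmx A -> A *m z = 0 ->
  foldl (@parsum R d) A (pairmap (mw_adj G) u p) *m (z + (y u - y (last u p))) = 0.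
Proof.
move=> y_edge; elim=> [|v p IHp] u A z psdA Az /=; first by rewrite subrr addr0.
have psduv := mw_adj_psdmx u v.
have -> : z + (y u - y (last v p)) = z + (y u - y v) + (y v - y (last v p)).
  by rewrite -!addrA addKr.
apply: IHp; first exact: parsum_psdmx.
by rewrite mulmxDr parsum_cker_l // add0r parsum_cker_r.
Qed.

Lemma path_ker_telescope (y : 'I_n -> 'cV[R]_d) u p :
  (forall i j, mw_adj G i j *m (y i - y j) = 0) ->
  y u - y (last u p) \in path_ker G u p.
Proof.
move=> y_edge; apply/ckerP; rewrite /path_weight.
case: p => [|v p] /=; first by rewrite subrr mulmx0.
have -> : y u - y (last v p) = (y u - y v) + (y v - y (last v p)).
  by rewrite addrA subrK.
by apply: foldl_parsum_telescope => //; exact: mw_adj_psdmx.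
Qed.

Lemma same_cluster_paths_ker i j : \dim (paths_ker G i j) = 0%N -> same_cluster G i j.
Proof.
move=> /eqP; rewrite dimv_eq0 => /eqP ker0 x /ckerP Lx0.
apply/eqP; rewrite -subr_eq0 -memv0 -ker0 /paths_ker memvE.
apply/subv_bigcapP => p /and3P[_ /eqP <- _]; rewrite -memvE.
apply: (@path_ker_telescope (fun k => submxcol x k)) => k l.
exact: mw_laplacian_cker_edge.
Qed.

Lemma mw_connected_same_cluster :
  (forall i j, i != j -> same_cluster G i j) -> mw_connected G.
Proof.
move=> cluster; rewrite /mw_connected.
have dimE : (\sum_(i < n) d = d * n)%N by rewrite sum_nat_const card_ord mulnC.
case: (posnP n) => [n0|n_gt0].
  (* Without vertices, the truncated difference [d * n - d] is 0, the rank of an empty matrix. *)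
  have dn0 : (d * n = 0)%N by rewrite n0 muln0.
  apply/eqP; rewrite dn0 sub0n -leqn0.
  by apply: leq_trans (rank_leq_row _) _; rewrite dimE dn0.
pose i0 := Ordinal n_gt0; pose J : 'M[R]_(d, \sum_(i < n) d) := \mxrow_(j < n) 1%:M.
have rankJ : \rank J = d.
  apply/eqP; rewrite -/(row_free J); apply/row_freeP.
  (* This right inverse of [J] selects the block at [i0]. *)
  exists (\mxcol_(j < n) (j == i0)%:R%:M).
  rewrite mul_mxrow_mxcol (bigD1 i0) // eqxx mulmx1 big1 => [|j /negPf->]; first exact: addr0.
  by rewrite raddf0 mulmx0.
(* The rows spanned by [J] are those with equal blocks. Symmetry of the Laplacian identifies its row
   kernel with the transposed column kernel. *)
have kerJ : (kermx (mw_laplacian G) == J)%MS.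
  apply/andP; split.
    apply/row_subP => k; set v := row k _.
    have Lv : mw_laplacian G *m v^T = 0.
      apply: trmx_inj; rewrite trmx_mul trmxK mw_laplacian_sym trmx0.
      by apply/sub_kermxP; exact: row_sub.
    suff -> : v = submxrow v i0 *m J by exact: submxMl.
    rewrite mul_mxrow; apply/mxrowP => j; rewrite mxrowK mulmx1.
    apply: trmx_inj; rewrite !tr_submxrow.
    have [-> //|ji] := eqVneq j i0.
    by apply: cluster => //; apply/ckerP.
  apply/sub_kermxP/trmx_inj; rewrite trmx_mul mw_laplacian_sym trmx0.
  apply/mxcolP => i; rewrite submxcol_mw_laplacian_mul submxcol0.
  by apply: big1 => j _; rewrite /J tr_mxrow !mxcolK subrr mulmx0.
(* The bound on the rank is what lets the truncated subtraction in rank-nullity be inverted. *)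
have rk := rank_leq_row (mw_laplacian G); have := mxrank_ker (mw_laplacian G).
rewrite (eqmxP kerJ) rankJ; move: (\rank _) rk => r; rewrite dimE => rk dE.
by rewrite [X in (_ - X)%N]dE subKn.
Qed.

End Laplacian.

Local Close Scope ring_scope.

Theorem theorem1 (R : realType) (d n : nat) (hd : 2 <= d)
    (G : mwgraph R d n) (hG : topologically_connected G) :
  (forall i j : 'I_n, \dim (paths_ker G i j) = 0 -> same_cluster G i j) /\
  ((forall i j : 'I_n, i != j -> \dim (paths_ker G i j) = 0) ->
   mw_connected G).
Proof.
split=> [i j|ker0]; first exact: same_cluster_paths_ker.
by apply: mw_connected_same_cluster => i j /ker0; exact: same_cluster_paths_ker.
Qed.
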